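(* Let $d\ge2$, let $\sigma_1\in\mathcal S_d$ be a transposition and $\sigma_2\in\mathcal S_d$ a cycle of length $d$. Then the Hurwitz space $\mathrm{HUR}_{d,t}(\mathbb P^1)$ is irreducible for the fixed type $t=([2],t(\sigma_1\sigma_2^{-1}),[d])$. There are exactly $[\frac d2]$ different types of this form (as $\sigma_1$ runs over all transpositions and $\sigma_2$ over all cycles of length $d$ in $\mathcal S_d$).
   Context: $\mathcal S_d$ is the symmetric group on $\{1,\dots,d\}$ acting on the right. If $\sigma\in\mathcal S_d$ is a product of disjoint cycles of lengths $k_1\ge\dots\ge k_m\ge2$ (fixed points omitted), its type is $t(\sigma)=[k_1,\dots,k_m]$. The type $([2],t(\sigma_1\sigma_2^{-1}),[d])$ denotes the unordered collection of these three cycle types (a trivial permutation contributes nothing). $[a]$ is the integer part of $a$. For a degree $d$ ramified covering $f:C\to\mathbb P^1$ with branch points $q_1,\dots,q_b$, a base point $o\in\mathbb P^1\setminus\{q_i\}$ and a numbering of $f^{-1}(o)$, the monodromy $\mu:\pi_1(\mathbb P^1\setminus\{q_i\},o)\to\mathcal S_d$ is obtained by lifting loops. A good geometric base is a system of generators $\gamma_1,\dots,\gamma_b$, $\gamma_i$ going along a path to a point near $q_i$, around $q_i$ once positively and back, different $\gamma_i$ meeting only at $o$, with $\gamma_1\cdots\gamma_b=\mathbf 1$ (the boundary of a disc containing all $q_i$). The local monodromies are $\mu(\gamma_i)$, and the (monodromy factorization) type of $f$ is the unordered collection of cycle types of its local monodromies. $\mathrm{HUR}_{d,b}(\mathbb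 P^1)$ is the set of isomorphism classes of degree $d$ coverings of $\mathbb P^1$ with exactly $b$ branch points, with the structure of an unramified covering of $\mathbb P^{(b)}\setminus\Delta$ ($\mathbb P^{(b)}$ the symmetric product of $b$ copies of $\mathbb P^1$, $\Delta$ the locus of $b$-tuples with coinciding points): the fibre over $B_0$ is the set of $b$-tuples of non-identity elements of $\mathcal S_d$ with product $\mathbf 1$ modulo simultaneous conjugation, and $\pi_1(\mathbb P^{(b)}\setminus\Delta,B_0)$ (the sphere braid group) acts through Hurwitz moves $(\dots,\tau_i,\tau_{i+1},\dots)\mapsto(\dots,\tau_i\tau_{i+1}\tau_i^{-1},\tau_i,\dots)$. Irreducible components are the connected components. $\mathrm{HUR}_{d,t}(\mathbb P^1)$ is the union of those irreducible components whose coverings have type $t$. *)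

(* Defs.v *)
From HB Require Import structures.
From mathcomp Require Import all_boot all_order all_algebra all_fingroup.
From mathcomp Require Import finmap multiset generic_quotient complex.
From mathcomp Require Import all_classical all_reals all_analysis.

Set Implicit Arguments.
Unset Strict Implicit.
Unset Printing Implicit Defensive.

Import Order.TTheory GRing.Theory Num.Theory.
Import numFieldNormedType.Exports.

Local Open Scope nat_scope.
Local Open Scope mset_scope.

(* Products of permutations are read from left to right, (s * t) x = t (s x),
   i.e. 'S_d acts on the right. *)

Definition is_transposition d (s : 'S_d) : Prop :=
  exists x y : 'I_d, x != y /\ s = tperm x y.

(* Only meaningful for k >= 2. *)
Definition is_cycle_of_length d (k : nat) (s : 'S_d) : Prop :=
  exists2 x : 'I_d, #|porbit s x| = k &
    forall y, y \notin porbit s x -> s y = y.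

Definition cycle_type d (s : 'S_d) : seq nat :=
  sort geq [seq k <- [seq #|c| | c : {set 'I_d} <- enum (porbits s)] | 2 <= k].

(* Unordered collections of cycle types; the empty type, which is the one of
   the identity, is dropped. *)
Definition type_collection (ts : seq (seq nat)) : {mset seq nat} :=
  seq_mset [seq t <- ts | t != [::]].

Definition three_type d (s1 s2 : 'S_d) : {mset seq nat} :=
  type_collection [:: [:: 2]; cycle_type (s1 * s2^-1)%g; [:: d]].

Section Factorizations.
Variables d b : nat.
Implicit Types (s : b.-tuple 'S_d) (X : {set b.-tuple 'S_d}).

Definition is_factorization s : bool :=
  all (fun g => g != 1%g) s && (\prod_(i < b) tnth s i == 1)%g.

Definition conj_class s : {set b.-tuple 'S_d} :=
  [set map_tuple (conjg^~ g) s | g : 'S_d]%SET.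

Definition hurwitz_fibre : {set {set b.-tuple 'S_d}} :=
  [set conj_class s | s in [set s | is_factorization s]]%SET.

(* To be used with j = i + 1. *)
Definition hurwitz_move (i j : 'I_b) s : b.-tuple 'S_d :=
  [tuple if k == i then (tnth s i * tnth s j * (tnth s i)^-1)%g
         else if k == j then tnth s i else tnth s k | k < b].

Definition hurwitz_move_class (i j : 'I_b) X : {set b.-tuple 'S_d} :=
  [set hurwitz_move i j s | s in X]%SET.

Definition factorization_type s : {mset seq nat} :=
  type_collection [seq cycle_type g | g <- s].

End Factorizations.

Local Close Scope nat_scope.
Local Close Scope mset_scope.
Local Open Scope classical_set_scope.
Local Open Scope ring_scope.

Section SymmetricProduct.
Variables (R : realType) (b : nat).

(* The complex projective line as the Riemann sphere; None is infinity, and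
   R[i]^o is the field of complex numbers with its norm topology. *)
Definition P1 : topologicalType := one_point_compactification (R[i])^o.

Definition P1pow : topologicalType := {ptws 'I_b -> P1}.

Definition same_points (x y : P1pow) : bool :=
  `[< exists s : 'S_b, forall k, y k = x (s k) >].

Lemma same_points_refl : reflexive same_points.
Proof. by move=> x; apply/asboolP; exists 1%g => k; rewrite perm1. Qed.

Lemma same_points_sym : symmetric same_points.
Proof.
suff h x y : same_points x y -> same_points y x.
  by move=> x y; apply/idP/idP; exact: h.
move=> /asboolP[s xy]; apply/asboolP; exists s^-1%g => k.
by rewrite xy permKV.
Qed.

Lemma same_points_trans : transitive same_points.
Proof.
move=> y x z /asboolP[s xy] /asboolP[u yz]; apply/asboolP.
by exists (u * s)%g => k; rewrite yz xy permM.
Qed.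

Canonical same_points_equiv :=
  EquivRel same_points same_points_refl same_points_sym same_points_trans.

Definition sym_product : topologicalType :=
  quotient_topology {eq_quot same_points_equiv}%qT.

Definition sym_point (x : P1pow) : sym_product := (\pi x)%qT.

(* The complement of the big diagonal. *)
Definition off_diagonal : set sym_product :=
  [set sym_point x | x in [set x : P1pow | injective x]].

Definition base_configuration : sym_product :=
  sym_point (fun k : 'I_b => Some (k%:R : R[i])).

Definition cis (x : R) : R[i] := (cos x +i* sin x)%C.

(* For j = i + 1 and t in [0, 1], the points i and j of the base configuration
   exchange places by a clockwise half turn around their midpoint. Take a base
   point o high in the upper half-plane and the good geometric base whose k-th
   loop goes down straight to the k-th point: its product taken from left to
   right is trivial. At the end of the half turn the loop around the i-th point,
   which passed between o and the j-th one, has become the j-th loop, so the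
   new local monodromies are (.., g_i g_j g_i^-1, g_i, ..). *)
Definition half_twist (i j : 'I_b) (t : R) : sym_product :=
  let mid := (i%:R + j%:R) / 2 in
  let arm := cis (- (pi * t)) / 2 in
  sym_point (fun k : 'I_b =>
    Some (if k == i then mid - arm
          else if k == j then mid + arm else k%:R : R[i])).

End SymmetricProduct.

Section Covering.
Variables (E X : topologicalType).

Definition evenly_covered (p : E -> X) (U : set X) : Prop :=
  exists (I : Type) (V : I -> set E),
    [/\ forall i, open (V i), trivIset setT V, p @^-1` U = \bigcup_i V i &
        forall i, exists s : X -> E,
          [/\ {within U, continuous s},
              forall x, U x -> V i (s x) /\ p (s x) = x &
              forall e, V i e -> s (p e) = e] ].

(* p is an unramified covering of the open subset A of X. *)
Definition unramified_covering (A : set X) (p : E -> X) : Prop :=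
  [/\ continuous p, forall e, A (p e) &
      forall x, A x ->
        exists U : set X, [/\ open U, U x, U `<=` A & evenly_covered p U] ].

End Covering.

(* HUR_{d,b}(P^1): the unramified covering of the space of b-point subsets of
   P^1 whose fibre over the base configuration is the set of factorizations
   modulo conjugation, on which the fundamental group acts through the Hurwitz
   moves. The half twists below generate the fundamental group, so these data
   determine the covering up to isomorphism. hur_tuples is meaningful on the
   fibre over the base configuration only. *)
Record hurwitz_space (R : realType) (d b : nat) := HurwitzSpace {
  hur_space :> topologicalType;
  hur_branch : hur_space -> sym_product R b;
  hur_tuples : hur_space -> {set b.-tuple 'S_d};
  hur_covering : unramified_covering (@off_diagonal R b) hur_branch;
  hur_fibreE : set_bij (hur_branch @^-1` [set base_configuration R b])
                       [set` hurwitz_fibre d b] hur_tuples;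
  hur_monodromy : forall (i j : 'I_b) (c : R -> hur_space),
    j = i.+1%N :> nat ->
    {within `[0, 1], continuous c} ->
    (forall t, t \in `[0, 1] -> hur_branch (c t) = half_twist i j t) ->
    hur_tuples (c 1) = hurwitz_move_class i j (hur_tuples (c 0))
}.

(* HUR_{d,t}(P^1). The space being a manifold, its irreducible components are
   the connected ones; each of them meets the fibre over the base
   configuration, where the type of a covering is read off. *)
Definition hurwitz_space_of_type (R : realType) (d : nat) (t : {mset seq nat}%mset)
    (H : hurwitz_space R d (size t)) : set H :=
  \bigcup_(x in [set x : H | hur_branch x = base_configuration R (size t) /\
                  exists2 s, s \in hur_tuples x & factorization_type s = t])
    connected_component [set: H] x.

Arguments hurwitz_space_of_type [R d] t H _.

Definition irreducible_space (H : topologicalType) (A : set H) : Prop :=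
  A !=set0 /\ connected A.

(* Main.v *)
(** The half twists are defined and stay off the diagonal for all times, so they
    lift to paths in the Hurwitz space; hence two points of the fibre over the base
    configuration whose tuples differ by a Hurwitz move lie in the same component.
    Hurwitz moves permute the cycle types arbitrarily, so every factorization of the
    given type can be brought to the form (a, b, c) with a a transposition, c a
    d-cycle and a b c = 1. Writing a = (x, c^m x), the permutation b = a c^-1 has
    two cycles, of lengths m and d - m. Thus the type of b determines m up to
    m <-> d - m, that is, up to exchanging the two points of a, and the bijection
    c^i x |-> c'^i x' conjugates any two such triples with the same m. The types
    correspond to the unordered pairs {m, d - m}, i.e. to 1 <= m <= d / 2. *)

Require Import Defs.
From mathcomp Require Import all_boot all_order all_algebra all_fingroup.
From mathcomp Require Import finmap multiset zify.
Set Implicit Arguments.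
Unset Strict Implicit.
Unset Printing Implicit Defensive.

(** * Cycle types of a transposition times a full cycle *)

Lemma perm_sort_geq (s t : seq nat) : perm_eq s t -> sort geq s = sort geq t.
Proof.
move/perm_sortP; apply.
- by move=> m n; exact: leq_total.
- by move=> m n p mn pm; exact: leq_trans pm mn.
- by move=> m n; rewrite andbC -eqn_leq => /eqP.
Qed.

Section CycleType.
Variable d : nat.
Implicit Types (s c g : 'S_d) (x y z : 'I_d).
Local Open Scope group_scope.

Lemma porbitJ s g x : porbit (s ^ g) (g x) = g @: porbit s x.
Proof.
apply/setP=> z; apply/porbitP/imsetP => [[i ->]|[_ /porbitP[i ->] ->]].
  by exists ((s ^+ i) x); rewrite ?mem_porbit // -conjXg permJ.
by exists i; rewrite -conjXg permJ.
Qed.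

Lemma porbitsJ s g : porbits (s ^ g) = [set g @: (C : {set 'I_d}) | C in porbits s].
Proof.
apply/setP=> C; apply/imsetP/imsetP => [[x _ ->]|[_ /imsetP[x _ ->] ->]].
  exists (porbit s (g^-1 x)); first exact: imset_f.
  by rewrite -porbitJ permKV.
by exists (g x); rewrite // porbitJ.
Qed.

Lemma cycle_typeJ s g : cycle_type (s ^ g) = cycle_type s.
Proof.
rewrite /cycle_type; apply: perm_sort_geq.
apply: perm_filter; rewrite porbitsJ.
have inj : injective (fun C : {set 'I_d} => g @: C).
  exact: imset_inj perm_inj.
have -> : [seq #|(C : {set 'I_d})| | C <- enum (porbits s)] =
   [seq #|(C : {set 'I_d})| | C <- [seq g @: (C : {set 'I_d}) | C <- enum (porbits s)]].
  by rewrite -map_comp; apply: eq_map => C /=; rewrite card_imset //; exact: perm_inj.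
apply: perm_map; apply: uniq_perm; rewrite ?enum_uniq ?map_inj_uniq ?enum_uniq //.
move=> C; rewrite mem_enum; apply/imsetP/mapP => -[D hD ->]; exists D => //.
  by rewrite mem_enum.
by rewrite mem_enum in hD.
Qed.

Lemma mem_cycle_type s k :
  (k \in cycle_type s) = (2 <= k) && (k \in [seq #|C| | C : {set 'I_d} <- enum (porbits s)]).
Proof. by rewrite mem_sort mem_filter. Qed.

Lemma cycle_type_porbit s k : k \in cycle_type s -> exists x, #|porbit s x| = k.
Proof.
rewrite mem_cycle_type => /andP[_ /mapP[C]]; rewrite mem_enum => /imsetP[x _ ->] ->.
by exists x.
Qed.

Lemma porbit_cycle_type s x : s x != x -> #|porbit s x| \in cycle_type s.
Proof.
move=> sx; rewrite mem_cycle_type; apply/andP; split; last first.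
  by apply/map_f; rewrite mem_enum imset_f.
have -> : 2 = #|[set x; s x]| by rewrite cards2 eq_sym sx.
apply/subset_leq_card/subsetP=> z; rewrite !inE => /orP[]/eqP->.
  exact: porbit_id.
by have := mem_porbit s 1 x; rewrite expg1.
Qed.

Lemma porbit_fix s x : s x = x -> porbit s x = [set x].
Proof.
move=> sx; apply/setP=> z; rewrite inE; apply/porbitP/eqP=> [[i ->]|->].
  by rewrite permX; elim: i => //= i ->.
by exists 0; rewrite expg0 perm1.
Qed.

Lemma cycle_type1 : cycle_type (1 : 'S_d) = [::].
Proof.
case E: (cycle_type _) => [//|k l].
have kin : k \in cycle_type (1 : 'S_d) by rewrite E mem_head.
have [x kE] := cycle_type_porbit kin; move: kin.
by rewrite mem_cycle_type -kE porbit_fix ?perm1 ?cards1 //.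
Qed.

Lemma cycle_type_eq0 s : (cycle_type s == [::]) = (s == 1).
Proof.
apply/eqP/eqP => [s0|->]; last exact: cycle_type1.
apply/permP=> x; rewrite perm1; apply/eqP/negPn/negP=> /porbit_cycle_type.
by rewrite s0.
Qed.

Lemma porbit_card_full s x : #|porbit s x| = d -> porbit s x = [set: 'I_d].
Proof. by move=> h; apply/eqP; rewrite eqEcard subsetT cardsT card_ord h leqnn. Qed.

Lemma cycle_type_cycle s x : 2 <= d -> #|porbit s x| = d -> cycle_type s = [:: d].
Proof.
move=> d2 h; rewrite /cycle_type.
have -> : porbits s = [set [set: 'I_d]].
  apply/setP=> C; rewrite inE; apply/imsetP/eqP => [[y _ ->]|->].
    apply/eqP; rewrite -(porbit_card_full h) eq_porbit_mem.
    by rewrite (porbit_card_full h) inE.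
  by exists x; rewrite // (porbit_card_full h).
by rewrite enum_set1 /= cardsT card_ord d2.
Qed.

Lemma cycle_type_fix s k x y : cycle_type s = [:: k] -> #|porbit s x| = k ->
  2 <= k -> y \notin porbit s x -> s y = y.
Proof.
move=> sk xk k2 yx; apply/eqP/negPn/negP => sy.
move: sk; rewrite /cycle_type => /(congr1 size); rewrite size_sort size_filter /=.
move/eqP; rewrite count_map.
(* If [s] moved [y], the orbits of [x] and [y] would be two distinct orbits of size at least 2,
   while the type has a single entry. *)
have : 1 < count (fun C : {set 'I_d} => 2 <= #|C|) (enum (porbits s)); last first.
  by move=> + /eqP h; rewrite [X in 1 < X]h.
have -> : 2 = size [:: porbit s x; porbit s y] by [].
rewrite -size_filter; apply: uniq_leq_size.
  by rewrite /= inE eq_sym eq_porbit_mem yx.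
move=> C; rewrite !inE mem_filter mem_enum => /orP[]/eqP->; rewrite imset_f // andbT.
  by rewrite /= xk.
by have := porbit_cycle_type sy; rewrite mem_cycle_type => /andP[].
Qed.

Lemma cycle_type2_tperm s : cycle_type s = [:: 2] -> is_transposition s.
Proof.
move=> s2; have [|x x2] := @cycle_type_porbit s 2; first by rewrite s2 mem_head.
have sx : s x != x.
  by apply/eqP=> /porbit_fix xE; rewrite xE cards1 in x2.
have ssx : s (s x) = x by have := iter_porbit s x; rewrite x2.
exists x, (s x); split; first by rewrite eq_sym.
apply/permP=> z; case: tpermP => [->|->|/eqP zx /eqP zsx] //.
apply: (cycle_type_fix s2 x2) => //.
by rewrite porbit_traject x2 /= !inE negb_or; exact/andP.
Qed.

Lemma tperm_cycle_type x y : x != y -> cycle_type (tperm x y) = [:: 2].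
Proof.
move=> xy; rewrite /cycle_type.
have orb z : z \in [set x; y] -> porbit (tperm x y) z = [set x; y].
  move=> hz; apply/eqP; rewrite eqEsubset; apply/andP; split; apply/subsetP => w.
    move=> /porbitP[i ->]; rewrite permX; elim: i => //= i; rewrite !inE.
    by move=> /orP[]/eqP->; rewrite ?tpermL ?tpermR eqxx ?orbT.
  have t1 := mem_porbit (tperm x y) 1 z; rewrite expg1 in t1.
  move: hz t1 (porbit_id (tperm x y) z); rewrite !inE.
  by move=> /orP[]/eqP->; rewrite ?tpermL ?tpermR => ? ? /orP[]/eqP->.
have orb1 z : z \notin [set x; y] -> porbit (tperm x y) z = [set z].
  by rewrite !inE negb_or => /andP[zx zy]; rewrite porbit_fix // tpermD // eq_sym.
rewrite filter_map -[RHS]/(sort geq [:: 2]); congr sort.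
suff -> : [seq C <- enum (porbits (tperm x y)) | 2 <= #|(C : {set 'I_d})|] = [:: [set x; y]].
  by rewrite /= cards2 xy.
apply/perm_small_eq => //; apply: uniq_perm => //.
  by apply: filter_uniq; exact: enum_uniq.
move=> C; rewrite mem_filter mem_enum inE; apply/andP/eqP.
  move=> [C2 /imsetP[z _ CE]]; rewrite {}CE in C2 *.
  case: (boolP (z \in [set x; y])) => [/orb //|/orb1 zE].
  by rewrite zE cards1 in C2.
move=> ->; rewrite cards2 xy; split=> //.
by apply/imsetP; exists x => //; rewrite orb // !inE eqxx.
Qed.

Section FullCycle.
Variables (c : 'S_d) (x : 'I_d).
Hypothesis cx : #|porbit c x| = d.

Lemma full_cycle_card y : #|porbit c y| = d.
Proof.
have : y \in porbit c x by rewrite porbit_card_full // inE.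
by rewrite -eq_porbit_mem => /eqP->.
Qed.

Lemma full_cycle_expg : c ^+ d = 1.
Proof.
apply/permP=> y; rewrite perm1 permX.
by have := iter_porbit c y; rewrite full_cycle_card.
Qed.

Lemma full_cycle_powP y : exists2 i, i < d & y = (c ^+ i) x.
Proof.
have : y \in porbit c x by rewrite porbit_card_full // inE.
rewrite porbit_traject cx => /trajectP[i id ->].
by exists i; rewrite // permX.
Qed.

Lemma full_cycle_pow_inj i j : i < d -> j < d -> (c ^+ i) x = (c ^+ j) x -> i = j.
Proof.
move=> id jd; have := uniq_traject_porbit c x; rewrite cx => u.
rewrite !permX -!(nth_traject _ (n := d)) // => /eqP.
by rewrite nth_uniq ?size_traject // => /eqP.
Qed.

End FullCycle.

(** The map c^i x |-> c'^i x' is well defined and bijective because both orbits are full with period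
    [d]. Base points are prescribed so that [g] can later match two transpositions given by
    positions along the cycles. *)
Lemma full_cycle_conj c c' x x' : #|porbit c x| = d -> #|porbit c' x'| = d ->
  exists2 g, c ^ g = c' & forall i, g ((c ^+ i) x) = (c' ^+ i) x'.
Proof.
move=> cx cx'.
pose k z := index z (traject c x d).
have kd z : k z < d.
  rewrite -[X in _ < X](size_traject c x d) index_mem.
  by have := porbit_traject c x z; rewrite cx porbit_card_full // inE => <-.
have kK z : (c ^+ k z) x = z.
  rewrite permX -(nth_traject _ (kd z)) nth_index //.
  by rewrite -index_mem size_traject kd.
have d0 : 0 < d := leq_ltn_trans (leq0n _) (kd x).
have f_inj : injective (fun z => (c' ^+ k z) x').
  by move=> y z /(full_cycle_pow_inj cx' (kd y) (kd z)) yz; rewrite -(kK y) yz kK.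
have gE i : perm f_inj ((c ^+ i) x) = (c' ^+ i) x'.
  (* The index [k] lies below [d], so it recovers the exponent [i] only modulo [d]; both exponents
     are reduced before comparison. *)
  rewrite permE /= -(expg_mod i (full_cycle_expg cx)).
  rewrite -(expg_mod i (full_cycle_expg cx')).
  by congr ((c' ^+ _) x'); apply: (full_cycle_pow_inj cx); rewrite ?kd ?ltn_pmod //.
exists (perm f_inj) => //; apply/permP=> z.
have [i _] := full_cycle_powP cx' z; rewrite -gE => ->.
by rewrite permJ -[c _]permM -expgSr !gE expgSr permM.
Qed.

(* Along the points c^i x, the permutation s steps down from b - 1 to a and then
   jumps back to b - 1. *)
Lemma porbit_descent s c x a b : #|porbit c x| = d -> a < b <= d ->
  s ((c ^+ a) x) = (c ^+ b.-1) x ->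
  (forall i, a < i < b -> s ((c ^+ i) x) = (c ^+ i.-1) x) ->
  porbit s ((c ^+ a) x) =i [seq (c ^+ i) x | i <- iota a (b - a)].
Proof.
move=> cx /andP[ab bd] sa si z; apply/porbitP/mapP.
  move=> [n ->]; rewrite permX; elim: n => [|n [i]] /=.
    by exists a; rewrite // mem_iota leqnn subnKC // ltnW.
  rewrite mem_iota subnKC ?(ltnW ab) // => /andP[ai ib] ->.
  case: (eqVneq i a) => [->|ia].
    by exists b.-1; rewrite // mem_iota; lia.
  exists i.-1; first by rewrite mem_iota; lia.
  by rewrite si //; lia.
move=> [i]; rewrite mem_iota subnKC ?(ltnW ab) // => /andP[ai ib] ->.
(* The first application of [s] jumps from position a to b - 1; each further one steps down, so
   position b - 1 - n is reached after n + 1 applications. *)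
suff h n : n < b - a -> exists m, (c ^+ (b.-1 - n)) x = (s ^+ m) ((c ^+ a) x).
  by have [|m] := h (b.-1 - i); [lia | rewrite subKn; [exists m | lia]].
elim: n => [|n IHn] nb; first by exists 1%N; rewrite expg1 sa subn0.
have [|m hm] := IHn; first lia.
exists m.+1; rewrite expgSr permM -hm si; last lia.
by rewrite subnS.
Qed.

(* Cycles of length 1 are dropped: [m = 1] gives [[:: d - 1]], or [[::]] if
   [d = 2]. *)
Definition two_cycle_type m := sort geq [seq k <- [:: m; d - m] | 2 <= k].

(** Away from positions 0 and m, [t] is c^-1 and steps down by one. Position 0 is first swapped to m
    and then sent to m - 1; position m is swapped to 0 and sent to d - 1. Hence the orbits are the
    intervals [0, m) and [m, d). *)
Lemma cycle_type_tperm_full_cycle c x m : #|porbit c x| = d -> 0 < m < d ->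
  cycle_type (tperm x ((c ^+ m) x) * c^-1) = two_cycle_type m.
Proof.
move=> cx /andP[m0 md]; set t := tperm _ _ * _.
pose p i := (c ^+ i) x.
have p0 : p 0 = x by rewrite /p expg0 perm1.
have p_inj i j : i < d -> j < d -> p i = p j -> i = j by exact: full_cycle_pow_inj.
have cVp i : 0 < i -> c^-1 (p i) = p i.-1.
  by case: i => // i _; rewrite /p expgSr permM permK.
have tp i : 0 < i < d -> i != m -> t (p i) = p i.-1.
  move=> /andP[i0 id] im; rewrite permM tpermD ?cVp //.
    by rewrite -p0; apply/eqP => /p_inj; lia.
  by apply/eqP => /p_inj; lia.
have o0 := @porbit_descent t c x 0 m cx.
have om := @porbit_descent t c x m d cx.
have {}o0 : porbit t (p 0) =i [seq p i | i <- iota 0 m].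
  rewrite -[in iota 0 m](subn0 m); apply: o0; first lia.
    by rewrite permM -/(p 0) p0 tpermL cVp.
  by move=> i im; apply: tp; lia.
have {}om : porbit t (p m) =i [seq p i | i <- iota m (d - m)].
  apply: om; first lia.
    (* Writing [x] as c^d x shows that c^-1 carries it to position d - 1. *)
    by rewrite permM tpermR -[in LHS](perm1 x) -(full_cycle_expg cx) cVp //; lia.
  by move=> i im; apply: tp; lia.
have card_iota a b (C : {set 'I_d}) : a + b <= d -> C =i [seq p i | i <- iota a b] -> #|C| = b.
  move=> abd CE; rewrite (eq_card CE) (card_uniqP _) ?size_map ?size_iota //.
  rewrite map_inj_in_uniq ?iota_uniq // => i j; rewrite !mem_iota => hi hj.
  by apply: p_inj; lia.
have c0 : #|porbit t (p 0)| = m by apply: card_iota o0; lia.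
have cm : #|porbit t (p m)| = d - m by apply: card_iota om; lia.
rewrite /cycle_type /two_cycle_type; apply: perm_sort_geq.
apply: perm_filter.
have -> : [:: m; d - m] = [seq #|(C : {set 'I_d})| | C <- [:: porbit t (p 0); porbit t (p m)]].
  by rewrite /= c0 cm.
apply: perm_map.
apply: uniq_perm; rewrite ?enum_uniq //=.
  rewrite inE andbT eq_sym eq_porbit_mem o0; apply/mapP => -[i].
  by rewrite mem_iota => im /p_inj; lia.
move=> C; rewrite mem_enum !inE; apply/imsetP/orP => [[z _ ->]|[]/eqP->];
  [|by exists (p 0)|by exists (p m)].
have [i id ->] := full_cycle_powP cx z; rewrite !eq_porbit_mem o0 om.
case: (ltnP i m) => im; [left|right]; apply/mapP; exists i; rewrite // mem_iota; lia.
Qed.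

Lemma two_cycle_typeC m : m <= d -> two_cycle_type (d - m) = two_cycle_type m.
Proof.
move=> md; apply: perm_sort_geq.
by apply: perm_filter; rewrite subKn // (perm_catC [:: _] [:: _]).
Qed.

Lemma mem_two_cycle_type k m :
  (k \in two_cycle_type m) = (2 <= k) && ((k == m) || (k == d - m)).
Proof. by rewrite mem_sort mem_filter !inE. Qed.

(** As the two lengths add up to [d], a single surviving entry determines the pair; if none
    survives, then d = 2 and m = n = 1. *)
Lemma two_cycle_type_inj m n : 0 < m < d -> 0 < n < d ->
  two_cycle_type m = two_cycle_type n -> m = n \/ m = d - n.
Proof.
move=> hm hn mn.
move: (mem_two_cycle_type m m) (mem_two_cycle_type (d - m) m).
rewrite mn !mem_two_cycle_type !eqxx orbT; lia.
Qed.

Lemma two_cycle_type_eq0 m : 0 < m < d -> two_cycle_type m = [::] -> d = 2.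
Proof.
move=> hm m0; move: (mem_two_cycle_type m m) (mem_two_cycle_type (d - m) m).
rewrite m0 !in_nil !eqxx orbT; lia.
Qed.

End CycleType.

(** * Factorizations of the given type up to simultaneous conjugation *)

Section TripleTypes.
Variable d : nat.
Implicit Types (a b c g : 'S_d) (x y z : 'I_d) (m n : nat).
Local Open Scope group_scope.

(** For d = 2 the middle entry is empty and disappears in [type_collection], leaving two types
    instead of three. *)
Definition std_types m : seq (seq nat) := [:: [:: 2]; two_cycle_type d m; [:: d]].

Lemma std_types_inj m n : 0 < m < d -> 0 < n < d ->
  type_collection (std_types m) = type_collection (std_types n) -> m = n \/ m = (d - n)%N.
Proof.
move=> hm hn /eq_seq_msetP /=.
case: eqP => [/two_cycle_type_eq0 d2 _|_]; first by have := d2 hm; lia.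
case: eqP => [/two_cycle_type_eq0 d2 _|_]; first by have := d2 hn; lia.
(* The common types [2] and [d] cancel, and the middle ones remain to be compared. *)
rewrite /= perm_cons (perm_cat2r [:: [:: d]] [:: _] [:: _])
  => /perm_mem/(_ (two_cycle_type d m)).
by rewrite !inE eqxx => /esym/eqP; exact: two_cycle_type_inj.
Qed.

Lemma full_cycle_tperm c x a : #|porbit c x| = d -> is_transposition a ->
  exists y m, [/\ 0 < m < d, #|porbit c y| = d & a = tperm y ((c ^+ m) y)].
Proof.
move=> cx [y [z [yz ->]]]; have cy := full_cycle_card cx y.
have [m md zE] := full_cycle_powP cy z; exists y, m; rewrite -zE; split=> //.
by rewrite md andbT lt0n; apply: contraNneq yz => m0; rewrite zE m0 expg0 perm1.
Qed.

Lemma three_typeE a c : 2 <= d -> is_transposition a -> is_cycle_of_length d c ->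
  exists2 m, 0 < m < d &
    [/\ cycle_type a = [:: 2], cycle_type (a * c^-1) = two_cycle_type d m &
        cycle_type c = [:: d]].
Proof.
move=> d2 ha [x cx _]; have [y [m [hm cy aE]]] := full_cycle_tperm cx ha.
exists m => //; rewrite {2}aE cycle_type_tperm_full_cycle // (cycle_type_cycle d2 cx).
by split=> //; have [w [z [wz ->]]] := ha; rewrite tperm_cycle_type.
Qed.

(** The relation and a^-1 = a force b = a c^-1, whose type determines the distance along [c] between
    the points of [a] up to n <-> d - n. *)
Lemma triple_normal_form a b c m : 2 <= d -> 0 < m < d -> cycle_type a = [:: 2] ->
  cycle_type b = two_cycle_type d m -> cycle_type c = [:: d] -> a * b * c = 1 ->
  exists x, [/\ #|porbit c x| = d, a = tperm x ((c ^+ m) x) & b = a * c^-1].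
Proof.
move=> d2 hm /cycle_type2_tperm ha tb tc abc.
have [|x0 cx0] := @cycle_type_porbit d c d; first by rewrite tc mem_head.
have bE : b = a * c^-1.
  have aV : a^-1 = a by have [x [y [_ ->]]] := ha; rewrite tpermV.
  by rewrite -[LHS](mulKg a) -[in LHS](mulgK c (a * b)) abc mul1g aV.
have [x [n [hn cx aE]]] := full_cycle_tperm cx0 ha.
have : two_cycle_type d n = two_cycle_type d m.
  by rewrite -tb bE aE cycle_type_tperm_full_cycle.
case/two_cycle_type_inj => // nm; first by exists x; rewrite -nm.
(* When n = d - m, the other point of the transposition is taken as base point: m further steps
   along [c] complete the cycle back to [x]. *)
exists ((c ^+ n) x); split=> //; first exact: full_cycle_card cx _.
rewrite -permM -expgD nm subnK; last by lia.
by rewrite (full_cycle_expg cx) perm1 tpermC -nm.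
Qed.

Lemma triple_conj a b c a' b' c' m : 2 <= d -> 0 < m < d ->
  [/\ cycle_type a = [:: 2], cycle_type b = two_cycle_type d m &
      cycle_type c = [:: d]] -> a * b * c = 1 ->
  [/\ cycle_type a' = [:: 2], cycle_type b' = two_cycle_type d m &
      cycle_type c' = [:: d]] -> a' * b' * c' = 1 ->
  exists g, [/\ a ^ g = a', b ^ g = b' & c ^ g = c'].
Proof.
move=> d2 hm [ta tb tc] abc [ta' tb' tc'] abc'.
have [x [cx aE bE]] := triple_normal_form d2 hm ta tb tc abc.
have [x' [cx' aE' bE']] := triple_normal_form d2 hm ta' tb' tc' abc'.
have [g cg gE] := full_cycle_conj cx cx'.
have ag : a ^ g = a'.
  by rewrite aE aE' tpermJ gE; have := gE 0; rewrite !expg0 !perm1 => ->.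
by exists g; split=> //; rewrite bE bE' conjMg conjVg ag cg.
Qed.

(** Treats d = 2 together with the other degrees: there [s] has only two entries, and inserting b =
    1 restores a triple. *)
Lemma std_types_split (s : seq 'S_d) m : 2 <= d -> 0 < m < d ->
  [seq cycle_type a | a <- s] = [seq t <- std_types m | t != [::]] ->
  \prod_(a <- s) a = 1 ->
  exists a b c, [/\ s = [seq a <- [:: a; b; c] | a != 1],
    [/\ cycle_type a = [:: 2], cycle_type b = two_cycle_type d m &
      cycle_type c = [:: d]] & a * b * c = 1].
Proof.
move=> d2 hm sE; rewrite unlock /= => prod1.
have ne1 a t l : cycle_type a = t :: l -> a != 1 by move=> h; rewrite -cycle_type_eq0 h.
move: sE; rewrite /=; case: eqP => [two0|/eqP two0] /=.
  case: s prod1 => [|a [|c [|? ?]]] /= ac // [ta tc]; exists a, 1, c.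
  rewrite eqxx (ne1 _ _ _ ta) (ne1 _ _ _ tc) two0 cycle_type1; split=> //.
  by move: ac; rewrite !mulg1.
case: s prod1 => [|a [|b [|c [|? ?]]]] /= abc // [ta tb tc]; exists a, b, c.
rewrite (ne1 _ _ _ ta) (ne1 _ _ _ tc) -cycle_type_eq0 tb two0; split=> //.
by move: abc; rewrite mulg1 mulgA.
Qed.

Lemma std_types_conj (s u : seq 'S_d) m : 2 <= d -> 0 < m < d ->
  [seq cycle_type a | a <- s] = [seq t <- std_types m | t != [::]] ->
  [seq cycle_type a | a <- u] = [seq t <- std_types m | t != [::]] ->
  \prod_(a <- s) a = 1 -> \prod_(a <- u) a = 1 ->
  exists g, u = [seq a ^ g | a <- s].
Proof.
move=> d2 hm ts tu ps pu.
have [a [b [c [-> tabc abc]]]] := std_types_split d2 hm ts ps.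
have [a' [b' [c' [-> tabc' abc']]]] := std_types_split d2 hm tu pu.
have [g [ag bg cg]] := triple_conj d2 hm tabc abc tabc' abc'.
exists g; rewrite -[in LHS]ag -[in LHS]bg -[in LHS]cg.
(* Being trivial is invariant under conjugation, so the filter commutes with it. *)
rewrite -[LHS]/([seq a <- [seq a ^ g | a <- [:: a; b; c]] | a != 1]) filter_map.
by congr map; apply: eq_filter => z /=; rewrite conjg_eq1.
Qed.

Lemma exists_full_cycle : 0 < d -> exists c x, #|porbit c x| = d.
Proof.
(* The witness is the successor modulo [d], whose i-th power sends 0 to i. *)
case: d => // e _; pose c : 'S_e.+1 := perm (@ordS_inj e.+1); exists c, ord0.
have cX i : i < e.+1 -> (c ^+ i) ord0 = i :> nat.
  elim: i => [|i IHi] ie; first by rewrite expg0 perm1.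
  by rewrite expgSr permM permE /= IHi ?modn_small // ltnW.
suff -> : porbit c ord0 = [set: 'I_e.+1] by rewrite cardsT card_ord.
apply/setP=> z; rewrite inE; apply/porbitP; exists z; apply/val_inj.
by rewrite /= cX.
Qed.

End TripleTypes.

(** * Hurwitz moves on factorizations *)

Section Braid.
Variables (d : nat).
Implicit Types (s u l : seq 'S_d) (x y : 'S_d).
Local Open Scope group_scope.

(** Sequences can be split and concatenated freely; [braid_tuple] transfers the moves to tuples. *)
Inductive braid : seq 'S_d -> seq 'S_d -> Prop :=
| braid_refl s : braid s s
| braid_move l1 x y l2 s :
    braid (l1 ++ x * y * x^-1 :: x :: l2) s -> braid (l1 ++ x :: y :: l2) s.

Lemma braid_trans s u l : braid s u -> braid u l -> braid s l.
Proof. by elim=> // l1 x y l2 s' _ IH /IH; exact: braid_move. Qed.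

Lemma braid_cons x s u : braid s u -> braid (x :: s) (x :: u).
Proof.
elim=> [s'|l1 y z l2 s' _ IH]; first exact: braid_refl.
by rewrite -cat_cons; apply: braid_move.
Qed.

Lemma braid_prod s u : braid s u -> \prod_(x <- s) x = \prod_(x <- u) x.
Proof.
elim=> // l1 x y l2 s' _ <-; rewrite !big_cat !big_cons /=.
by rewrite !mulgA mulgKV.
Qed.

(* Moving x to the left across l1 conjugates x and leaves l1 unchanged. *)
Lemma braid_front l1 x l2 : exists2 x', braid (l1 ++ x :: l2) (x' :: l1 ++ l2) &
  cycle_type x' = cycle_type x.
Proof.
elim: l1 => [|y l1 [x' br xx']] /=; first by exists x => //; exact: braid_refl.
exists (y * x' * y^-1); last by rewrite -xx' -(cycle_typeJ x' y^-1) conjgE invgK mulgA.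
apply: braid_trans (braid_cons y br) _.
by apply: (@braid_move [::]); exact: braid_refl.
Qed.

(** Selection sort: an entry of the first required type is brought to the front, which leaves the
    other entries intact, and the rest is sorted by induction. *)
Lemma braid_perm_types (L : seq (seq nat)) s : perm_eq [seq cycle_type x | x <- s] L ->
  exists2 u, braid s u & [seq cycle_type x | x <- u] = L.
Proof.
elim: L s => [|t L IH] s.
  move=> /perm_nilP; case: s => // _; exists [::] => //; exact: braid_refl.
move=> sL; have : t \in [seq cycle_type x | x <- s] by rewrite (perm_mem sL) mem_head.
move=> /mapP[x /splitPr xs tE]; case: xs sL => l1 l2.
rewrite map_cat /= -tE perm_catC cat_cons perm_cons perm_catC -map_cat => /IH[u br uL].
have [x' br' xx'] := braid_front l1 x l2.
by exists (x' :: u); [exact: braid_trans br' (braid_cons x' br)|rewrite /= xx' uL tE].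
Qed.

(** * Hurwitz moves on tuples and conjugacy classes of factorizations *)

Section Tuples.
Variable b : nat.
Implicit Types (v w : b.-tuple 'S_d).

Inductive tbraid : b.-tuple 'S_d -> b.-tuple 'S_d -> Prop :=
| tbraid_refl v : tbraid v v
| tbraid_move (i j : 'I_b) v w : j = i.+1 :> nat ->
    tbraid (hurwitz_move i j v) w -> tbraid v w.

Lemma hurwitz_moveE (i j : 'I_b) v l1 x y l2 : j = i.+1 :> nat -> size l1 = i ->
  tval v = l1 ++ x :: y :: l2 ->
  tval (hurwitz_move i j v) = l1 ++ x * y * x^-1 :: x :: l2.
Proof.
move=> ji l1i vE.
have sz : b = (size l1 + (size l2).+2)%N by rewrite -(size_tuple v) vE size_cat.
have vn k : tnth v k = nth 1 (l1 ++ x :: y :: l2) k by rewrite (tnth_nth 1) vE.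
apply: (@eq_from_nth _ 1); first by rewrite size_tuple size_cat sz.
move=> k; rewrite size_tuple => kb; rewrite -(tnth_nth 1 _ (Ordinal kb)) tnth_mktuple.
rewrite !vn !nth_cat l1i ltnn subnn ji ltnNge leqnSn subSnn /= -!val_eqE /= ji.
case: ltngtP => [ki|ik|->] /=; last by rewrite subnn.
  by rewrite ltn_eqF // ltnW.
case: eqP => [->|/eqP ki]; first by rewrite subSnn.
by case E: (k - i)%N => [|[|n]] //; lia.
Qed.

Lemma braid_tuple s u v : braid s u -> tval v = s -> exists2 w, tval w = u & tbraid v w.
Proof.
move=> br; elim: br v => [{}s|l1 x y l2 {}s _ IH] v vE.
  by exists v => //; exact: tbraid_refl.
have sz : b = (size l1 + (size l2).+2)%N by rewrite -(size_tuple v) vE size_cat.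
have ib : size l1 < b by lia.
have jb : (size l1).+1 < b by lia.
have [|w wE br] := IH (hurwitz_move (Ordinal ib) (Ordinal jb) v).
  exact: hurwitz_moveE.
by exists w => //; exact: tbraid_move br.
Qed.

Lemma hurwitz_moveJ (i j : 'I_b) v g :
  hurwitz_move i j (map_tuple (conjg^~ g) v) = map_tuple (conjg^~ g) (hurwitz_move i j v).
Proof.
apply/eq_from_tnth => k; rewrite [RHS]tnth_map /hurwitz_move !tnth_mktuple !tnth_map.
by case: ifP => _; [rewrite !conjMg conjVg|case: ifP].
Qed.

Lemma conj_class_id v : v \in conj_class v.
Proof.
apply/imsetP; exists 1 => //; apply/val_inj => /=.
by rewrite -[LHS]map_id; apply: eq_map => a; rewrite conjg1.
Qed.

Lemma conj_class_eq v w : v \in conj_class w -> conj_class v = conj_class w.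
Proof.
move=> /imsetP[g _ ->]; apply/setP=> z; apply/imsetP/imsetP => -[h _ ->].
  exists (g * h) => //; apply/val_inj; rewrite /= -map_comp; apply: eq_map => x /=.
  by rewrite conjgM.
exists (g^-1 * h) => //; apply/val_inj; rewrite /= -map_comp; apply: eq_map => x /=.
by rewrite -conjgM mulKVg.
Qed.

Lemma is_factorizationJ v g :
  is_factorization v -> is_factorization (map_tuple (conjg^~ g) v).
Proof.
move=> /andP[/allP v1 /eqP pv]; apply/andP; split.
  by apply/allP => _ /mapP[a /v1 a1 ->]; rewrite conjg_eq1.
have -> : (\prod_(i < b) tnth (map_tuple (conjg^~ g) v) i = (\prod_(i < b) tnth v i) ^ g).
  rewrite (big_morph (conjg^~ g) (fun x y => conjMg x y g) (conj1g g)).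
  by apply: eq_bigr => i _; rewrite tnth_map.
by rewrite pv conj1g.
Qed.

(** The entries of a factorization are nontrivial, so no type is dropped on the side of [v]. *)
Lemma factorization_type_perm v (ts : seq (seq nat)) : is_factorization v ->
  factorization_type v = type_collection ts ->
  perm_eq [seq cycle_type x | x <- v] [seq t <- ts | t != [::]].
Proof.
move=> /andP[/allP v1 _] /eq_seq_msetP; congr (perm_eq _ _).
by apply/all_filterP/allP => _ /mapP[x /v1 x1 ->]; rewrite cycle_type_eq0.
Qed.

(** Moves bring both tuples to the same order of types while preserving the product; the ordered
    tuples are then conjugate by [std_types_conj]. *)
Lemma factorizations_braid_conj v w m : 2 <= d -> 0 < m < d ->
  is_factorization v -> is_factorization w ->
  factorization_type v = type_collection (std_types d m) ->
  factorization_type w = type_collection (std_types d m) ->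
  exists v' w', [/\ tbraid v v', tbraid w w' & conj_class v' = conj_class w'].
Proof.
move=> d2 hm fv fw tv tw.
have [s br sT] := braid_perm_types (factorization_type_perm fv tv).
have [u br' uT] := braid_perm_types (factorization_type_perm fw tw).
have [v' v's vv'] := braid_tuple br erefl.
have [w' w'u ww'] := braid_tuple br' erefl.
exists v', w'; split=> //.
have [||g uE] := std_types_conj d2 hm sT uT.
- by rewrite -(braid_prod br) big_tuple; apply/eqP; have /andP[] := fv.
- by rewrite -(braid_prod br') big_tuple; apply/eqP; have /andP[] := fw.
apply/esym/conj_class_eq/imsetP; exists g => //.
by apply/val_inj; rewrite /= w'u v's uE.
Qed.

End Tuples.

Lemma type_collection_neq1 (l : seq 'S_d) :
  type_collection [seq cycle_type g | g <- l & g != 1] =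
  type_collection [seq cycle_type g | g <- l].
Proof.
rewrite /type_collection !filter_map; congr (seq_mset (map _ _)).
by rewrite -filter_predI; apply: eq_filter => g /=; rewrite cycle_type_eq0 andbb.
Qed.

Lemma size_type_collection (l : seq 'S_d) :
  size (type_collection [seq cycle_type g | g <- l]) = size [seq g <- l | g != 1].
Proof.
rewrite (perm_size (perm_eq_seq_mset _)) filter_map size_map.
by congr size; apply: eq_filter => g /=; rewrite cycle_type_eq0.
Qed.

(** The witness is (s1, s1 s2^-1, s2), with product s1^2 = 1; trivial entries are removed, which
    matters when d = 2. *)
Lemma three_type_factorization (s1 s2 : 'S_d) : (2 <= d) ->
  is_transposition s1 -> is_cycle_of_length d s2 ->
  exists2 v : (size (three_type s1 s2)).-tuple 'S_d,
    is_factorization v & factorization_type v = three_type s1 s2.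
Proof.
move=> hd hs1 hs2; have [m hm [t1 _ t2]] := three_typeE hd hs1 hs2.
pose l : seq 'S_d := [:: s1; s1 * s2^-1; s2].
have tE : three_type s1 s2 = type_collection [seq cycle_type g | g <- l].
  by rewrite /three_type /= t1 t2.
have szl : size [seq g <- l | g != 1] == size (three_type s1 s2).
  by rewrite tE size_type_collection.
exists (Tuple szl); last by rewrite [RHS]tE -type_collection_neq1.
apply/andP; split; first by apply/allP => g; rewrite mem_filter => /andP[].
rewrite -(big_tuple _ _ (Tuple szl) xpredT id) big_filter big_mkcond.
rewrite (eq_bigr id) => [|g _]; last by case: eqP.
rewrite !big_cons big_nil /= mulg1 mulgKV.
by have [y [z [_ ->]]] := hs1; rewrite tperm2.
Qed.

End Braid.

From mathcomp Require Import ring lra complex.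
From mathcomp Require Import all_classical all_reals all_analysis.
Import Order.TTheory GRing.Theory Num.Theory.
Import numFieldNormedType.Exports.
Local Open Scope classical_set_scope.
Local Open Scope card_scope.

Local Open Scope ring_scope.

(** * Lifting of half twists *)

Section PathLifting.
Variables (R : realType) (E X : topologicalType).

Lemma continuous_glue (c g : R -> E) (a : R) : continuous c -> continuous g -> c a = g a ->
  continuous (fun u => if u <= a then c u else g u).
Proof.
move=> cc cg ca u W; case: (ltgtP u a) => [ua|au|->] Wu.
- have cW : \forall v \near u, W (c v) by exact: cc.
  have va : \forall v \near u, v < a by exact: lt_nbhsl.
  by apply: filterS2 cW va => v Wv va; rewrite /= (ltW va).
- have cW : \forall v \near u, W (g v) by exact: cg.
  have va : \forall v \near u, a < v by exact: lt_nbhsr.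
  by apply: filterS2 cW va => v Wv va; rewrite /= leNgt va.
- have cW : \forall v \near a, W (c v) by exact: cc.
  have gW : \forall v \near a, W (g v) by apply: cg; rewrite -ca.
  by apply: filterS2 cW gW => v /= Wc Wg; case: ifP.
Qed.

(** The section inverts [p] on the sheet through [e]. *)
Lemma evenly_covered_section (p : E -> X) (U : set X) (e : E) :
  evenly_covered p U -> open U -> U (p e) ->
  exists s : X -> E, [/\ {in U, continuous s}, forall x, U x -> p (s x) = x & s (p e) = e].
Proof.
move=> [I [V [_ _ pU Vs]]] oU Upe.
have : (p @^-1` U) e by [].
rewrite pU => -[i _ Vie]; have [s [cs sU sV]] := Vs i.
exists s; split; [by rewrite -continuous_open_subspace | by move=> x /sU[] | exact: sV].
Qed.

Lemma path_lifting (A : set X) (p : E -> X) (f : R -> X) (e0 : E) :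
  unramified_covering A p -> continuous f -> (forall t, A (f t)) -> p e0 = f 0 ->
  exists c : R -> E, [/\ continuous c, c 0 = e0 & forall t, 0 <= t <= 1 -> p (c t) = f t].
Proof.
move=> [_ _ covA] cf Af pe0.
(* The supremum of the t up to which a lift exists is 1, since around it f stays in
   an evenly covered set. *)
pose P (t : R) := 0 <= t <= 1 /\ exists c : R -> E,
  [/\ continuous c, c 0 = e0 & forall u, 0 <= u <= t -> p (c u) = f u].
have P0 : P 0.
  split; first by rewrite lexx ler01.
  exists (fun=> e0); split => // [|u u0]; first exact: cst_continuous.
  by rewrite pe0; congr f; lra.
have supP : has_sup [set t | P t].
  by split; [exists 0 | exists 1 => t [/andP[]]].
pose m := sup [set t | P t].
have ubm t : P t -> t <= m by move=> Pt; exact: (sup_upper_bound supP).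
have [U [oU Um UA ecU]] := covA _ (Af m).
have : \forall t \near m, U (f t) by apply: cf; exact: open_nbhs_nbhs.
move=> /nbhs_ballP[r /= r0 rU].
have [a [a01 [c [cc c0 cl]]]] := sup_adherent r0 supP; rewrite -/m => ma.
have am : a <= m by apply: ubm; split=> //; exists c.
pose b := Num.min 1 (m + r / 2).
have ab : a <= b by rewrite /b le_min; apply/andP; split; lra.
have bm : b <= m + r / 2 by rewrite /b ge_min lexx orbT.
have b1 : b <= 1 by rewrite /b ge_min lexx.
have Uf u : a <= u <= b -> U (f u).
  by move=> uab; apply: rU; rewrite /ball /= ltr_norml; lra.
have [|s [cs sp se]] := @evenly_covered_section p U (c a) ecU oU.
  by rewrite cl; [apply: Uf; rewrite lexx | lra].
(* Clamping the time to [a, b] keeps [f \o k] in [U], so that [s \o f \o k] is continuous on the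
   whole line and can be glued to [c] at [a]. *)
pose k (u : R) := Num.max a (Num.min u b).
have kab u : a <= k u <= b.
  by rewrite /k le_max lexx /= ge_max ab ge_min lexx orbT.
have ck : continuous k.
  move=> u; apply: (@continuous_max _ _ (fun=> a) (fun u => Num.min u b)).
    exact: cst_continuous.
  apply: (@continuous_min _ _ id (fun=> b)); first exact: cvg_id.
  exact: cst_continuous.
have cg : continuous (s \o f \o k).
  move=> u; apply: continuous_comp; first exact: ck.
  apply: continuous_comp; first exact: cf.
  by apply: cs; rewrite inE; exact: Uf.
have ka : k a = a by rewrite /k (min_idPl ab) maxxx.
have Pb : P b.
  split; first lra.
  exists (fun u => if u <= a then c u else (s \o f \o k) u); split.
  - by apply: continuous_glue => //=; rewrite ka -cl ?se //; lra.
  - by have /andP[-> _] := a01.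
  - move=> u ub; case: (lerP u a) => ua; first by apply: cl; lra.
    rewrite /= sp; last exact: Uf.
    by rewrite /k min_l ?max_r //; lra.
(* Since b <= m < m + r / 2, the minimum defining [b] must be 1. *)
have b_1 : b = 1.
  have := ubm _ Pb; rewrite /b; case: (lerP 1 (m + r / 2)) => //; lra.
by case: Pb => _; rewrite b_1.
Qed.

End PathLifting.

(** * Half twists as paths of configurations of distinct points *)

Section HalfTwist.
Variables (R : realType) (b : nat).
Implicit Types (i j k : 'I_b) (t : R).

Lemma real_complex_continuous : continuous (fun x : R => x%:C%C : R[i]^o).
Proof.
move=> x; apply/cvgrPdist_lt => e e0.
(* A positive element of [R[i]] is real, so the bound can be read in [R]. *)
have [eRe Re0] : e = (complex.Re e)%:C%C /\ 0 < complex.Re e.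
  by move: e0; rewrite ltcE /= => /andP[/eqP ie re]; split=> //;
    case: e ie {re} => ? ? /= ->.
have : \forall t \near x, `|x - t| < complex.Re e.
  by have /cvgrPdist_lt := @cvg_id _ (nbhs x); apply.
apply: filterS => t xt.
by rewrite -rmorphB /= normc_def /= expr0n addr0 sqrtr_sqr eRe ltcR.
Qed.

Lemma cis_continuous : continuous (fun x => cis x : R[i]^o).
Proof.
have E x : cis x = (cos x)%:C%C + 'i%C * (sin x)%:C%C :> R[i] by exact: complexE.
rewrite (_ : (fun x => _) = (fun x => (cos x)%:C%C + 'i%C * (sin x)%:C%C : R[i]^o)).
  move=> x; apply: cvgD.
    by apply: continuous_comp; [exact: continuous_cos|exact: real_complex_continuous].
  apply: cvgM; first exact: cvg_cst.
  by apply: continuous_comp; [exact: continuous_sin|exact: real_complex_continuous].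
by apply/funext => x; rewrite E.
Qed.

(** The lift of [half_twist] to ordered tuples, where continuity and distinctness are checked
    coordinatewise. *)
Definition twist_points i j t : P1pow R b := fun k =>
    Some (if k == i then (i%:R + j%:R) / 2 - cis (- (pi * t)) / 2
          else if k == j then (i%:R + j%:R) / 2 + cis (- (pi * t)) / 2 else k%:R : R[i]).

Lemma half_twist_continuous i j : continuous (@half_twist R b i j).
Proof.
have ca : continuous (fun t : R => cis (- (pi * t)) / 2 : R[i]^o).
  move=> t; apply: cvgM; last exact: cvg_cst.
  apply: (@continuous_comp R R R[i]^o (fun t => - (pi * t)) (fun x => cis x)).
    by apply: cvgN; apply: cvgM; [exact: cvg_cst|exact: cvg_id].
  exact: cis_continuous.
have cB : continuous (fun t : R => (i%:R + j%:R) / 2 - cis (- (pi * t)) / 2 : R[i]^o).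
  move=> t; apply: (@cvgB _ R[i]^o _ _ _ (fun=> _) (fun t => cis (- (pi * t)) / 2)).
    exact: cvg_cst.
  exact: ca.
have cD : continuous (fun t : R => (i%:R + j%:R) / 2 + cis (- (pi * t)) / 2 : R[i]^o).
  by move=> t; apply: cvgD; [exact: cvg_cst|exact: ca].
have ct : continuous (twist_points i j).
  (* The product topology is the supremum of the topologies pulled back along the coordinates. *)
  move=> t; apply/cvg_sup => k U.
  have /= -> := @nbhsE (initial_topology (fun f : P1pow R b => f k)) (twist_points i j t).
  case=> B [[C oC <- Ct]] BU.
  suff ck : {for t, continuous (fun u => twist_points i j u k)}.
    have Ck : \forall u \near t, C (twist_points i j u k).
      by apply: ck; exact: open_nbhs_nbhs.
    have h : \forall u \near t, U (twist_points i j u).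
      by apply: filterS Ck => u; exact: BU.
    exact: h.
  rewrite /twist_points; case: (k == i); [|case: (k == j); last exact: cst_continuous].
  - apply: (@continuous_comp R R[i]^o (P1 R)
      (fun u => (i%:R + j%:R) / 2 - cis (- (pi * u)) / 2) Some).
      exact: cB.
    exact: one_point_compactification_some_continuous.
  - apply: (@continuous_comp R R[i]^o (P1 R)
      (fun u => (i%:R + j%:R) / 2 + cis (- (pi * u)) / 2) Some).
      exact: cD.
    exact: one_point_compactification_some_continuous.
move=> t; apply: (@continuous_comp _ _ _ (twist_points i j) (@sym_point R b)); first exact: ct.
exact: pi_continuous.
Qed.

Lemma cis_eq_real (x y : R) : cis x = y%:C%C -> y ^+ 2 = 1.
Proof. by move=> [<- s0]; have := cos2Dsin2 x; rewrite s0 expr0n addr0. Qed.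

(** A moving point meets the fixed point k only if [cis x] is 2k - i - j up to sign. A real point of
    the unit circle has square 1, whereas (2k - i - j)^2 - 1 = 4 (k - i) (k - j) is nonzero. *)
Lemma half_twist_arm_neq i j k (x : R) : j = i.+1%N :> nat -> k != i -> k != j ->
  cis x != 2 * k%:R - i%:R - j%:R /\ cis x != - (2 * k%:R - i%:R - j%:R).
Proof.
move=> ji ki kj.
have ne : (2 * k%:R - i%:R - j%:R : R) ^+ 2 != 1.
  rewrite ji -[i.+1%:R]natr1 -subr_eq0.
  have -> : (2 * k%:R - i%:R - (i%:R + 1)) ^+ 2 - 1 =
      4 * (k%:R - i%:R) * (k%:R - (i%:R + 1)) :> R by ring.
  by rewrite !mulf_neq0 // ?subr_eq0 ?natr1 ?eqr_nat -?ji //.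
have E : 2 * k%:R - i%:R - j%:R = (2 * k%:R - i%:R - j%:R)%:C%C :> R[i].
  by rewrite !rmorphB rmorphM !rmorph_nat.
split; apply/eqP; rewrite E -?rmorphN => /cis_eq_real /eqP; apply/negP => //.
by rewrite sqrrN.
Qed.

Lemma cis_neq0 (x : R) : cis x != 0.
Proof. by apply/eqP => /cis_eq_real /eqP; rewrite expr0n eq_sym oner_eq0. Qed.

Lemma twist_points_inj i j t : j = i.+1%N :> nat -> injective (twist_points i j t).
Proof.
move=> ji k l; rewrite /twist_points => -[].
have w0 := cis_neq0 (- (pi * t)).
have wk := @half_twist_arm_neq i j _ (- (pi * t)) ji.
move: (cis _) w0 wk => w w0 wk.
(* [E1] and [E2] treat a collision of the i-th, respectively j-th, moving point with a fixed one;
   [E3] treats a collision of the two moving points. *)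
have E1 (k' : 'I_b) : (i%:R + j%:R) / 2 - w / 2 = k'%:R -> w = - (2 * k'%:R - i%:R - j%:R).
  by move=> <-; field.
have E2 (k' : 'I_b) : (i%:R + j%:R) / 2 + w / 2 = k'%:R -> w = 2 * k'%:R - i%:R - j%:R.
  by move=> <-; field.
have E3 : (i%:R + j%:R) / 2 - w / 2 = (i%:R + j%:R) / 2 + w / 2 -> w = 0.
  move=> /eqP; rewrite -subr_eq0 => /eqP h; apply/eqP; rewrite -oppr_eq0.
  by apply/eqP; rewrite -h; field.
have {}E3 : (i%:R + j%:R) / 2 - w / 2 <> (i%:R + j%:R) / 2 + w / 2.
  by move=> /E3 /eqP; rewrite (negPf w0).
have {}E1 (k' : 'I_b) : k' != i -> k' != j -> (i%:R + j%:R) / 2 - w / 2 <> k'%:R.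
  by move=> k'i k'j /E1 /eqP; apply/negP; have [] := wk _ k'i k'j.
have {}E2 (k' : 'I_b) : k' != i -> k' != j -> (i%:R + j%:R) / 2 + w / 2 <> k'%:R.
  by move=> k'i k'j /E2 /eqP; apply/negP; have [] := wk _ k'i k'j.
case: (eqVneq k i) => [->|ki]; case: (eqVneq l i) => [->|li] //.
- by case: (eqVneq l j) => [_ /E3|lj /(E1 _ li lj)].
- by case: (eqVneq k j) => [_ /esym/E3|kj /esym/(E1 _ ki kj)].
case: (eqVneq k j) => [->|kj]; case: (eqVneq l j) => [->|lj] //.
- by move=> /(E2 _ li lj).
- by move=> /esym/(E2 _ ki kj).
by move=> /eqP; rewrite eqr_nat => /eqP/val_inj.
Qed.

Lemma half_twist_off_diagonal i j t : j = i.+1%N :> nat -> off_diagonal (half_twist i j t).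
Proof. by move=> ji; exists (twist_points i j t) => //; exact: twist_points_inj. Qed.

Lemma half_twist0 i j : j = i.+1%N :> nat -> half_twist i j 0 = base_configuration R b.
Proof.
move=> ji; congr sym_point; apply/funext=> k; congr Some.
have -> : cis (- (pi * 0)) = 1 :> R[i] by rewrite mulr0 oppr0 /cis cos0 sin0.
case: eqVneq => [->|_]; last case: eqVneq => [->|_] //;
  by rewrite ji -[i.+1%:R]natr1; field.
Qed.

Lemma half_twist1 i j : j = i.+1%N :> nat -> half_twist i j 1 = base_configuration R b.
Proof.
(* The half turn exchanges the points i and j, so the path closes up only in the symmetric product,
   through [tperm i j]. *)
move=> ji; apply/eqmodP/asboolP; exists (tperm i j) => k.
have -> : cis (- (pi * 1)) = - 1 :> R[i].
  by rewrite mulr1 /cis cosN sinN cospi sinpi oppr0; apply/eqP;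
    rewrite eq_complex /= oppr0 !eqxx.
have ij : i != j by rewrite -val_eqE /= ji; lia.
congr Some; case: tpermP => [->|->|/eqP/negPf-> /eqP/negPf->] //.
  by rewrite eqxx eq_sym (negPf ij) ji -[i.+1%:R]natr1; field.
by rewrite eqxx ji -[i.+1%:R]natr1; field.
Qed.

End HalfTwist.

(** * Components of the Hurwitz space *)

Section HurwitzComponents.
Variables (R : realType) (d b : nat) (H : hurwitz_space R d b).
Implicit Types (x y : H) (s : b.-tuple 'S_d).

Lemma hurwitz_move_component (i j : 'I_b) x : j = i.+1%N :> nat ->
  hur_branch x = base_configuration R b ->
  exists y, [/\ hur_branch y = base_configuration R b,
    hur_tuples y = hurwitz_move_class i j (hur_tuples x) &
    connected_component [set: H] x = connected_component [set: H] y].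
Proof.
move=> ji xB.
have [||c [cc c0 cl]] := path_lifting (e0 := x) (hur_covering H)
    (@half_twist_continuous R b i j).
- by move=> t; exact: half_twist_off_diagonal.
- by rewrite xB half_twist0.
exists (c 1); split.
- by rewrite cl ?half_twist1 // ler01 lexx.
- by rewrite -c0; apply: hur_monodromy => //; exact: continuous_subspaceT.
(* The image of [0, 1] under the lift is connected and contains both endpoints. *)
apply: same_connected_component; exists (c @` `[0, 1]); last first.
  by exists 1 => //=; rewrite in_itv /= ler01 lexx.
split=> //; first by exists 0 => //=; rewrite in_itv /= ler01 lexx.
apply: connected_continuous_connected; first exact: segment_connected.
exact: continuous_subspaceT.
Qed.

Lemma tbraid_component s s' x : tbraid s s' ->
  hur_branch x = base_configuration R b -> hur_tuples x = conj_class s ->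
  exists y, [/\ hur_branch y = base_configuration R b, hur_tuples y = conj_class s' &
    connected_component [set: H] x = connected_component [set: H] y].
Proof.
move=> br; elim: br x => [{}s|i j {}s {}s' ji _ IH] x xB xs; first by exists x.
have [y [yB ys ->]] := hurwitz_move_component ji xB.
(* Moves commute with simultaneous conjugation, hence send a whole conjugacy class onto a conjugacy
   class. *)
apply: IH => //; rewrite ys xs; apply/setP => u; apply/imsetP/imsetP.
  by move=> [_ /imsetP[g _ ->] ->]; exists g => //; rewrite hurwitz_moveJ.
move=> [g _ ->]; exists (map_tuple (conjg^~ g) s); first exact: imset_f.
by rewrite hurwitz_moveJ.
Qed.

End HurwitzComponents.

Lemma hurwitz_tuplesE (R : realType) d b (H : hurwitz_space R d b) (x : H) s :
  hur_branch x = base_configuration R b -> s \in hur_tuples x ->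
  is_factorization s /\ hur_tuples x = conj_class s.
Proof.
move=> xB; have [hf _ _] := hur_fibreE H.
have /imsetP[u] := hf x xB; rewrite inE => fu -> su.
split; last by rewrite (conj_class_eq su).
by have /imsetP[g _ ->] := su; exact: is_factorizationJ.
Qed.

(** * Irreducibility and the number of types *)

Theorem theorem3p5 (R : realType) (d : nat) (hd : (2 <= d)%N) :
  (forall s1 s2 : 'S_d, is_transposition s1 -> is_cycle_of_length d s2 ->
     forall HUR : hurwitz_space R d (size (three_type s1 s2)),
       irreducible_space (hurwitz_space_of_type (three_type s1 s2) HUR)) /\
  [set t | exists s1 s2 : 'S_d,
     [/\ is_transposition s1, is_cycle_of_length d s2 & t = three_type s1 s2] ]
    #= `I_(d %/ 2).
Proof.
split=> [s1 s2 hs1 hs2 H|].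
  have [m hm [t1 t12 t2]] := three_typeE hd hs1 hs2.
  have tE : three_type s1 s2 = type_collection (std_types d m) by rewrite /three_type t12.
  have [_ injH surjH] := hur_fibreE H.
  have [v fv tv] := three_type_factorization hd hs1 hs2.
  have [|x xB xv] := surjH (conj_class v).
    by apply: imset_f; rewrite inE.
  have xT : hurwitz_space_of_type (three_type s1 s2) H x.
    exists x; last exact: connected_component_refl.
    by split=> //; exists v => //; rewrite xv conj_class_id.
  split; first by exists x.
  (* The space is shown to be the single component of the point [x] just built. *)
  suff -> : hurwitz_space_of_type (three_type s1 s2) H = connected_component [set: H] x.
    exact: component_connected.
  apply/seteqP; split=> [y [z [zB [s sz st]]]|y xy]; last first.
    by exists x => //; split=> //; exists v => //; rewrite xv conj_class_id.
  have [fs zs] := hurwitz_tuplesE zB sz.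
  have [s' [v' [ss' vv' s'v']]] := factorizations_braid_conj hd hm fs fv
    (etrans st tE) (etrans tv tE).
  have [z' [z'B z's' ->]] := tbraid_component ss' zB zs.
  have [x' [x'B x'v' ->]] := tbraid_component vv' xB xv.
  (* Both points lie in the base fibre and carry the same conjugacy class, and [hur_tuples] is
     injective there. *)
  suff -> : z' = x' by [].
  by apply: injH; rewrite ?inE //= z's' x'v'.
have [c [x cx]] := exists_full_cycle (ltnW hd).
(* The shift by one matches [I_(d %/ 2)], which starts at 0, with the range 1 <= m <= d / 2. *)
pose f k := type_collection (std_types d k.+1).
have -> : [set t | exists s1 s2 : 'S_d,
     [/\ is_transposition s1, is_cycle_of_length d s2 & t = three_type s1 s2] ] =
   f @` `I_(d %/ 2).
  apply/seteqP; split => [_ [s1 [s2 [hs1 hs2 ->]]]|_ [k /= kd <-]].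
    have [m hm [_ t12 _]] := three_typeE hd hs1 hs2.
    have [md|md] := leqP m (d %/ 2).
      exists m.-1; first by rewrite /=; lia.
      by rewrite /f prednK ?/three_type ?t12 //; lia.
    (* A length m above d / 2 is replaced by its complement, which gives the same type. *)
    exists (d - m).-1; first by rewrite /=; lia.
    by rewrite /f prednK ?/three_type ?t12 /std_types ?two_cycle_typeC //; lia.
  have hk : (0 < k.+1 < d)%N by lia.
  exists (tperm x ((c ^+ k.+1)%g x)), c; split.
  - exists x, ((c ^+ k.+1)%g x); split => //; apply/eqP => e.
    suff : 0%N = k.+1 by [].
    by apply: (full_cycle_pow_inj cx); rewrite ?expg0 ?perm1 -?e //; lia.
  - by exists x => // y; rewrite porbit_card_full // inE.
  - by rewrite /three_type cycle_type_tperm_full_cycle.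
(* Two complementary lengths that are both at most d / 2 must be equal. *)
apply: inj_card_eq => k n; rewrite !inE /= => kd nd /std_types_inj.
by case; lia.
Qed.
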